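(* Let $\mathcal{S} = \langle S, +_S, \cdot_S, 0_S, 1_S \rangle$ be an arbitrary semiring, and let $\sim$ denote any equivalence relation on $\sigma$-LTSs that is finer than directed simulation equivalence and coarser than bisimilarity. There does not exist a class $\mathcal{C}$ of $\sigma$-LTSs such that, for all finite $\sigma$-LTSs $M_a$ and $N_b$, we have $\textrm{hom}_{\mathcal{S}}(\mathcal{C},M_a) = \textrm{hom}_{\mathcal{S}}(\mathcal{C},N_b)$ if and only if $M_a \sim N_b$.
   Context: A $\sigma$-LTS is a structure over a modal signature $\sigma$ (finitely many unary proposition letters, finitely many binary actions $R_i$, $i\in I$) with one distinguished element. A directed simulation from $M_a$ to $N_b$ is a relation $Z$ containing $(a,b)$ such that whenever $(m,n)\in Z$: every proposition letter true at $m$ is true at $n$; for each $R_i^M(m,s)$ there is $t$ with $R_i^N(n,t)$ and $(s,t)\in Z$; and for each $R_i^N(n,t)$ there is $s$ with $R_i^M(m,s)$ and $(s,t)\in Z$. $M_a$, $N_b$ are directed simulation equivalent if directed simulations exist in both directions; a bisimulation is such a $Z$ where moreover $m$ and $n$ satisfy exactly the same proposition letters, and $M_a$, $N_b$ are bisimilar if one exists. ''$\sim$ is finer than $\approx$'' means $M_a\sim N_b$ implies $M_a\approx N_b$; so here bisimilar LTSs are $\sim$-related and $\sim$-related LTSs are directed simulation equivalent. For a semiring $\mathcal{S}$, $\textrm{count}_\mathcal{S}(n)$ is $0_S$ if $n=0$ and the $n$-fold sum $1_S+_S\cdots+_S 1_S$ otherwise; $\textrm{hom}_{\mathcal{S}}(T_c,M_a)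 = \textrm{count}_\mathcal{S}(\text{number of homomorphisms from } T_c \text{ to } M_a \text{ mapping } c \text{ to } a)$, and $\textrm{hom}_{\mathcal{S}}(\mathcal{C},M_a)$ is the $\mathcal{C}$-indexed vector of these values.
   Formalization: The signature σ is assumed to have at least one action; with no actions the claim fails, since bisimilarity and directed simulation equivalence both mean ''same letters at the point'' and one-point LTSs characterize this whenever 0_S ≠ 1_S. *)

(* Defs.v *)
From mathcomp Require Import all_boot all_order all_algebra.
From mathcomp Require Import boolp classical_sets functions cardinality.
From Corelib Require Import RelationClasses.

Set Implicit Arguments.
Unset Strict Implicit.
Unset Printing Implicit Defensive.

Local Open Scope classical_set_scope.
Local Open Scope ring_scope.

Record modal_signature := ModalSignature {
  letter : finType;
  action : finType
}.

(* The carrier is an arbitrary type, so infinite structures are included. *)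
Record lts (sigma : modal_signature) := LTS {
  state :> Type;
  holds : letter sigma -> state -> Prop;
  trans : action sigma -> state -> state -> Prop;
  lts_point : state
}.

Definition finite_lts sigma (M : lts sigma) : Prop := finite_set [set: M].

Record directed_simulation sigma (M N : lts sigma) (Z : M -> N -> Prop) :
    Prop := DirectedSimulation {
  dsim_point : Z (lts_point M) (lts_point N);
  dsim_letter : forall m n, Z m n -> forall p, holds p m -> holds p n;
  dsim_forth : forall m n, Z m n -> forall i s, trans i m s ->
    exists2 t, trans i n t & Z s t;
  dsim_back : forall m n, Z m n -> forall i t, trans i n t ->
    exists2 s, trans i m s & Z s t
}.

Definition directed_simulation_equivalent sigma (M N : lts sigma) : Prop :=
  (exists Z : M -> N -> Prop, directed_simulation Z) /\
  (exists Z : N -> M -> Prop, directed_simulation Z).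

Definition bisimulation sigma (M N : lts sigma) (Z : M -> N -> Prop) : Prop :=
  directed_simulation Z /\
  (forall m n, Z m n -> forall p, holds p m <-> holds p n).

Definition bisimilar sigma (M N : lts sigma) : Prop :=
  exists Z : M -> N -> Prop, bisimulation Z.

Definition finer sigma (E F : lts sigma -> lts sigma -> Prop) : Prop :=
  forall M N, E M N -> F M N.

Record is_hom sigma (T M : lts sigma) (f : T -> M) : Prop := IsHom {
  hom_point : f (lts_point T) = lts_point M;
  hom_letter : forall p x, holds p x -> holds p (f x);
  hom_trans : forall i x y, trans i x y -> trans i (f x) (f y)
}.

(* The number of homomorphisms is only meaningful when there are finitely many,
   in particular when T and M are finite; it is 0 by convention otherwise. *)
Definition hom_number sigma (T M : lts sigma) : nat :=
  xget 0%N [set n | ([set f : T -> M | is_hom f] #= `I_n)%card].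

Definition count_in (S : pzSemiRingType) (n : nat) : S := n%:R.

Definition hom_in (S : pzSemiRingType) sigma (T M : lts sigma) : S :=
  count_in S (hom_number T M).

Definition hom_vector (S : pzSemiRingType) sigma (C : lts sigma -> Prop)
    (M : lts sigma) : {T : lts sigma | C T} -> S :=
  fun T => hom_in S (sval T) M.

(* Main.v *)
Require Import Defs.
From mathcomp Require Import all_boot all_order all_algebra.
From mathcomp Require Import boolp classical_sets functions cardinality.
From Corelib Require Import RelationClasses.

(** All complete LTSs (every letter holds everywhere, every transition is
    present) are bisimilar, so [hom_in S T] must agree on them for every [T] in
    the class. When [0 != 1] in [S], comparing one and two points forces [T] to
    be finite; if [T] has [n.+1] points, the number of homomorphisms into the
    complete LTS on [k] points is [k ^ n], so [k ^ n = 1] in [S] for all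
    [k > 0]. If [n > 0], put [q = 2 ^ n - 1]: then [1 + q = 1] and [q ^ n = 1]
    in [S], whence [1 + 1 = 1 + q * q ^ n.-1 = 1]. In all cases [hom_in S T M]
    only records whether a homomorphism from [T] to [M] exists. This cannot
    separate [a -> b -> c] from the same path with an additional dead end
    [a -> d], since these two are homomorphically equivalent; but they are not
    directed simulation equivalent. *)

Set Implicit Arguments.
Unset Strict Implicit.
Unset Printing Implicit Defensive.

Import GRing.Theory.

Local Open Scope classical_set_scope.

(** Sending [t] to [None] singles out the base point: a homomorphism is prescribed there, so [n]
    counts the points whose image is still to be chosen. *)
Lemma finite_pointed_bij (T : Type) (t : T) : finite_set [set: T] ->
  exists n, exists f : T -> option 'I_n,
    exists2 g, cancel f g /\ cancel g f & f t = None.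
Proof.
move=> finT.
have [n] : exists n, ([set: T] `\ t #= `I_n)%card.
  by apply/finite_setP; exact: finite_setD.
move=> /card_set_bijP[f0 /= [f0n f0inj f0surj]].
pose f x : option 'I_n := if `[< x = t >] then None else insub (f0 x).
have fE x : x <> t -> exists2 i : 'I_n, f x = Some i & val i = f0 x.
  move=> xt; rewrite /f asboolF //.
  by rewrite (insubT (fun i => i < n) (f0n x (conj I xt))); eexists.
have ft : f t = None by rewrite /f asboolT.
have finj : injective f.
  move=> x y; case: (pselect (x = t)) => [->|xt]; rewrite ?ft.
    by case: (pselect (y = t)) => [->//|/fE[i ->]].
  have [i -> ix] := fE x xt; case: (pselect (y = t)) => [->|yt].
    by rewrite ft.
  have [j -> jy] := fE y yt => -[ij].
  by apply: f0inj; rewrite ?inE -?ix -?jy ?ij.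
have fsurj y : exists x, f x = y.
  case: y => [i|]; last by exists t.
  have [x [_ xt] xi] := f0surj i (ltn_ord i).
  exists x; have [j -> jx] := fE x xt.
  by congr Some; apply: val_inj; rewrite jx.
have [g gK] := choice fsurj.
by exists n, f, g => //; split => //; exact: inj_can_sym.
Qed.

Lemma card_finType (X : finType) : ([set: X] #= `I_#|X|)%card.
Proof.
rewrite card_eq_sym; apply: card_eq_trans card_II _.
apply/card_bijP.
exists (fun i => exist _ (enum_val (sval i)) (mem_setT _)).
exists (fun x => exist _ (enum_rank (sval x)) (mem_setT _)).
  by move=> [i ii]; apply/val_inj; rewrite /= enum_valK.
by move=> [x xx]; apply/val_inj; rewrite /= enum_rankK.
Qed.

Definition homs sigma (T M : lts sigma) : set (T -> M) := [set f | is_hom f].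
Arguments homs {sigma} T M _ : rename.

Section HomNumber.
Variable sigma : modal_signature.
Implicit Types T M N : lts sigma.

Lemma finite_homs T M : finite_lts T -> finite_lts M -> finite_set (homs T M).
Proof.
move=> finT finM.
have [n [f [f' [fK f'K] _]]] := finite_pointed_bij (lts_point T) finT.
have [m [g [g' [gK g'K] _]]] := finite_pointed_bij (lts_point M) finM.
pose psi (h : {ffun option 'I_n -> option 'I_m}) : T -> M := g' \o h \o f.
apply: (@sub_finite_set _ _ (psi @` [set: _])).
  move=> h _; exists [ffun i => g (h (f' i))] => //.
  by apply/funext => x; rewrite /psi /= ffunE fK gK.
exact/finite_image/finite_finset.
Qed.

Lemma hom_number_unique T M n : (homs T M #= `I_n)%card -> hom_number T M = n.
Proof.
move=> Hn; apply: xget_unique => // m Hm; apply/card_eq_II.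
by rewrite card_eq_sym; apply: card_eq_trans Hm; rewrite card_eq_sym.
Qed.

Lemma card_homs T M : finite_set (homs T M) ->
  (homs T M #= `I_(hom_number T M))%card.
Proof. by move=> /finite_setP[n Hn]; rewrite (hom_number_unique Hn). Qed.

Lemma hom_number_infinite T M : infinite_set (homs T M) -> hom_number T M = 0.
Proof.
by move=> inf; apply: xgetPN => n Hn; apply: inf; apply/finite_setP; exists n.
Qed.

(** If [1 + 1 = 1], every positive count collapses to 1; if [T] is a single point, at most one
    homomorphism exists. *)
Lemma hom_in_exists (S : pzSemiRingType) T M :
    finite_lts T -> finite_lts M ->
    (1 + 1 = 1 :> S)%R \/ (forall x : T, x = lts_point T) ->
  hom_in S T M = (`[< exists f : T -> M, is_hom f >]%:R)%R.
Proof.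
move=> finT finM ST; rewrite /hom_in /count_in.
case: asboolP => [[f hf]|nex]; last first.
  rewrite (@hom_number_unique T M 0) // (_ : homs T M = set0) ?II0 //.
  by apply/seteqP; split => // f hf; apply: nex; exists f.
case: ST => [S11|T1].
  have := card_homs (finite_homs finT finM).
  case: (hom_number T M) => [|n _].
    by rewrite II0 card_eq0 => /eqP; rewrite -subset0 => /(_ f hf).
  by elim: n => //= n IHn; rewrite -addn1 natrD IHn.
rewrite (@hom_number_unique T M 1) //.
rewrite (_ : homs T M = [set f]) ?card_set1 //; apply/seteqP; split.
  move=> g hg; apply/funext => x.
  by rewrite (T1 x) (hom_point hf) (hom_point hg).
by move=> _ ->.
Qed.

(** The shift to [k.+1] states leaves room for a point, so [complete_lts 0] has one state. Every
    point-preserving map into it is a homomorphism. *)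
Definition complete_lts (k : nat) : lts sigma :=
  @LTS sigma 'I_k.+1 (fun _ _ => True) (fun _ _ _ => True) ord0.

Lemma complete_lts_bisimilar k l : bisimilar (complete_lts k) (complete_lts l).
Proof.
exists (fun _ _ => True); split => //.
by split => // *; exists ord0.
Qed.

Lemma is_hom_complete T k (f : T -> complete_lts k) :
  f (lts_point T) = ord0 -> is_hom f.
Proof. by move=> f0; split. Qed.

Lemma hom_number_complete0 T : hom_number T (complete_lts 0) = 1.
Proof.
apply: hom_number_unique.
rewrite (_ : homs _ _ = [set (fun=> ord0 : complete_lts 0)]).
  exact: card_set1.
apply/seteqP; split => [h _|_ ->]; last exact: is_hom_complete.
by apply/funext => x; rewrite [h x]ord1.
Qed.

Lemma finite_of_homs_complete T k :
  finite_set (homs T (complete_lts k.+1)) -> finite_lts T.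
Proof.
(* [ind x] is the indicator of [x] with the base point sent to [ord0], as homomorphisms require. The
   base point thus yields the constant map, and [ind] embeds [T] into the homomorphisms, because
   [ord_max] differs from [ord0] among [k.+2] states. *)
pose ind (x y : T) : complete_lts k.+1 :=
  if `[< y = x /\ y <> lts_point T >] then ord_max else ord0.
have ind_inj : injective ind.
  have aux x x' : ind x = ind x' -> x <> lts_point T -> x = x'.
    move=> /(congr1 (fun h => h x)); rewrite /ind => + xt.
    by rewrite asboolT //; case: asboolP => // -[].
  move=> x x' e; have [xt|xt] := pselect (x = lts_point T); last exact: aux xt.
  have [->//|x't] := pselect (x' = lts_point T); exact/esym/aux.
rewrite /finite_lts => /(finite_preimage (f := ind)) fin.
rewrite (_ : [set: T] = ind @^-1` homs T (complete_lts k.+1)).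
  by apply: fin => x y _ _; exact: ind_inj.
apply/seteqP; split => // x _; apply: is_hom_complete.
by rewrite /ind asboolF // => -[].
Qed.

(** The exponent is the number of points other than the base point: each of them may go to any of
    the [k.+1] states. *)
Lemma hom_number_complete T : finite_lts T ->
  exists2 n, forall k, hom_number T (complete_lts k) = k.+1 ^ n &
    n = 0 -> forall x : T, x = lts_point T.
Proof.
move=> finT.
have [n [f [f' [fK f'K] ft]]] := finite_pointed_bij (lts_point T) finT.
exists n; last first.
  move=> n0 x; apply: (can_inj fK); rewrite ft.
  by case: (f x) => // -[i]; rewrite n0.
move=> k; apply: hom_number_unique.
pose psi (h : {ffun 'I_n -> 'I_k.+1}) : T -> complete_lts k :=
  fun x => if f x is Some i then h i else ord0.
have -> : homs T (complete_lts k) = psi @` [set: _].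
  apply/seteqP; split => [h /hom_point h0|_ [h _ <-]]; last first.
    by apply: is_hom_complete; rewrite /psi ft.
  exists [ffun i => h (f' (Some i))] => //; apply/funext => x; rewrite /psi.
  case E: (f x) => [i|]; first by rewrite ffunE -E fK.
  by rewrite (_ : x = lts_point T) //; apply: (can_inj fK); rewrite E.
have psi_inj : injective psi.
  move=> h h' e; apply/ffunP => i.
  by have := congr1 (fun u => u (f' (Some i))) e; rewrite /psi f'K.
apply: card_eq_trans (inj_card_eq _) _; first by move=> ? ? _ _; exact: psi_inj.
have := card_finType {ffun 'I_n -> 'I_k.+1}.
by rewrite card_ffun !card_ord.
Qed.

End HomNumber.

Local Open Scope ring_scope.

Lemma idempotent_of_expn_eq1 (S : pzSemiRingType) (n : nat) :
  (forall k, (k.+1 ^ n.+1)%:R = 1 :> S) -> 1 + 1 = 1 :> S.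
Proof.
move=> pow1.
have [q q2] : exists q, (2 ^ n.+1 = q.+2)%N.
  have: (1 < 2 ^ n.+1)%N by rewrite -{1}(expn0 2) ltn_exp2l.
  by case: (2 ^ n.+1)%N => [|[|q]] // _; exists q.
(* Here [q.+1] is [2 ^ n.+1 - 1], so adding any multiple of it to 1 gives 1 again; [q.+1 ^ n.+1],
   which equals 1 in [S], is such a multiple. *)
have absorb j : 1 + (q.+1 * j)%:R = 1 :> S.
  elim: j => [|j IHj]; first by rewrite muln0 addr0.
  by rewrite mulnS natrD addrA -(natrD _ 1) add1n -q2 pow1.
by rewrite -{2}(pow1 q) expnS absorb.
Qed.

Section Counterexample.
Variable sigma : modal_signature.

(** The path is [None], [Some false], [Some true]. All actions share the same arrows, which makes
    the example uniform in the signature. *)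
Definition path_lts : lts sigma :=
  @LTS sigma (option bool) (fun _ _ => False)
    (fun _ x y => match x, y with
                  | None, Some false | Some false, Some true => True
                  | _, _ => False
                  end) None.

Definition dead_end_lts : lts sigma :=
  @LTS sigma (option bool + unit) (fun _ _ => False)
    (fun _ x y => match x, y with
                  | inl None, inl (Some false)
                  | inl (Some false), inl (Some true)
                  | inl None, inr _ => True
                  | _, _ => False
                  end) (inl None).

Lemma path_dead_end_hom : @is_hom sigma path_lts dead_end_lts inl.
Proof. by split => // i [[]|] [[]|]. Qed.

(** The dead end is folded onto the middle of the path; having no successors, it imposes no further
    condition. *)
Lemma dead_end_path_hom :
  @is_hom sigma dead_end_lts path_lts
    (fun x => if x is inl y then y else Some false).
Proof. by split => // i [[[]|]|[]] [[[]|]|[]]. Qed.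

Lemma is_hom_comp (T M N : lts sigma) (f : T -> M) (g : M -> N) :
  is_hom f -> is_hom g -> is_hom (g \o f).
Proof.
move=> [f0 fl ft] [g0 gl gt]; split => /=; first by rewrite f0 g0.
  by move=> p x /fl/gl.
by move=> i x y /ft/gt.
Qed.

Lemma dead_end_path_not_dsim (i : action sigma) :
  ~ directed_simulation_equivalent dead_end_lts path_lts.
Proof.
move=> [[Z [Z0 _ Zf Zb]] _].
(* The move to the dead end can only be matched by [Some false], whose step to [Some true] then has
   no counterpart from the dead end. *)
have [[[]|] //= _ Zd] := Zf _ _ Z0 i (inr tt) I.
by have [[[[]|]|[]]] := Zb _ _ Zd i (Some true) I.
Qed.

End Counterexample.

Theorem theorem6p5 (S : pzSemiRingType) (sigma : modal_signature)
    (has_action : (0 < #|action sigma|)%N)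
    (equiv : lts sigma -> lts sigma -> Prop)
    (equiv_equivalence : Equivalence equiv)
    (equiv_finer : finer equiv (@directed_simulation_equivalent sigma))
    (equiv_coarser : finer (@bisimilar sigma) equiv) :
  ~ (exists C : lts sigma -> Prop,
       forall M N : lts sigma, finite_lts M -> finite_lts N ->
         (@hom_vector S sigma C M = @hom_vector S sigma C N <-> equiv M N)).
Proof.
move=> [C HC]; have /card_gt0P[i _] := has_action.
apply: (@dead_end_path_not_dsim sigma i); apply/equiv_finer/HC.
- exact: finite_finset.
- exact: finite_finset.
apply/funext => -[T CT]; rewrite /hom_vector /=.
have [S01|S01] := pselect (0 = 1 :> S).
  have S0 (x : S) : x = 0 by rewrite -[x]mulr1 -S01 mulr0.
  by rewrite [LHS]S0 [RHS]S0.
have homC k l : hom_in S T (complete_lts sigma k) =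
                hom_in S T (complete_lts sigma l).
  have /HC : equiv (complete_lts sigma k) (complete_lts sigma l).
    exact/equiv_coarser/complete_lts_bisimilar.
  have finK m : finite_lts (complete_lts sigma m) by exact: finite_finset.
  by move=> /(_ (finK k) (finK l)) /(congr1 (@^~ (exist _ T CT))).
have finT : finite_lts T.
  (* For infinite [T] the count into two states is infinite, hence 0 by convention, while the count
     into one state is 1; [homC] would force [0 = 1]. *)
  apply: contrapT => infT; apply: S01; have := homC 0%N 1%N.
  rewrite /hom_in /count_in (@hom_number_infinite _ T (complete_lts sigma 1)).
    by rewrite hom_number_complete0.
  by move=> /finite_of_homs_complete.
have ST : 1 + 1 = 1 :> S \/ (forall x : T, x = lts_point T).
  have [[|n] homk T1] := hom_number_complete finT; first by right; exact: T1.
  left; apply: (@idempotent_of_expn_eq1 _ n) => k.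
  by have := homC k 0%N; rewrite /hom_in /count_in !homk exp1n.
(* Only existence of a homomorphism remains, and it transfers by composition with the maps between
   the two structures. *)
rewrite !hom_in_exists //; try exact: finite_finset.
congr (_%:R); congr nat_of_bool; apply: asbool_equiv_eq.
split => -[f hf]; eexists; apply: is_hom_comp hf _.
  exact: dead_end_path_hom.
exact: path_dead_end_hom.
Qed.
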